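(* Let $X$ be a thick convex digital disk in $\mathbb{Z}^2$. Let $A \subset X$. Then $A$ is a cold set for $(X,c_1)$ if and only if $A$ is a freezing set for $(X,c_1)$.
   Context: Adjacencies in $\mathbb{Z}^2$: distinct points $(x_1,x_2)$, $(y_1,y_2)$ are $c_2$-adjacent if $|x_i-y_i|\le 1$ for $i=1,2$; they are $c_1$-adjacent if moreover they differ in exactly one coordinate. For $\kappa\in\{c_1,c_2\}$ and $X\subset\mathbb{Z}^2$: a $\kappa$-path of length $k$ is a sequence $x_0,\dots,x_k$ with consecutive points equal or $\kappa$-adjacent; a set is $\kappa$-connected if any two of its points are joined by a $\kappa$-path in it; $d_\kappa(x,y)$ is the minimal length of a $\kappa$-path in $X$ from $x$ to $y$. $f:X\to X$ is in $C(X,\kappa)$ (is $\kappa$-continuous) if $\kappa$-adjacent points have equal or $\kappa$-adjacent images. $A\subset X$ is a freezing set for $(X,\kappa)$ if every $f\in C(X,\kappa)$ with $f|_A=\mathrm{id}_A$ equals $\mathrm{id}_X$. For $(X,\kappa)$ connected, $A\subset X$ is a cold set if every $f\in C(X,\kappa)$ with $f|_A=\mathrm{id}_A$ satisfies $d_\kappa(x,f(x))\le 1$ for all $x\in X$. A $c_2$-closed curve is a $c_2$-path $\{s_i\}_{i=0}^m$ with $s_0=s_m$ and $s_i\ne s_j$ whenever $0<|i-j|<m$. If $S\subset\mathbb{Z}^2$ is a $c_2$-closed curve such that $\mathbb{Z}^2\setminus S$ has two $c_1$-components, one finite and the other infinite, the finite one is denoted $Int(S)$ and the infinite one $Ext(S)$;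 then $D=S\cup Int(S)$ is a digital disk, $S$ is a bounding curve of $D$, and $Int(D)$ denotes $Int(S)$ when $S$ is understood. A digital line segment is a ($c_1$- or $c_2$-)connected collinear set of more than one point of $\mathbb{Z}^2$; it is horizontal or vertical (axis-parallel) or has slope $\pm1$ (slanted). The edges (sides) of $S$ are the maximal digital line segments in $S$. If edges $E_1,E_2$ of $S$ satisfy $E_1\cap E_2=\{p\}$, the interior angle at the vertex $p$ is the angle formed by $E_1$, $E_2$ and $Int(S)$. Thickness: a digital disk $X$ is thick if for some bounding curve $S$ of $X$ the following hold. (i) For every maximal slanted segment $\sigma$ of $S$ and every $p\in\sigma$ that is not an endpoint of $\sigma$, $X$ is slant-thick at $p$: there is $c\in X$ that is $c_2$-adjacent but not $c_1$-adjacent to $p$, where $c$ is the diagonal neighbor of $p$ off $\sigma$ (in the direction perpendicular to $\sigma$) on the interior side of $\sigma$. (ii) For every vertex $p$ of a $90^\circ$ interior angle $\theta$ of $S$, $X$ is $90^\circ$-thick at $p$: there is $q\in Int(X)$, in the interior of $\theta$, such that if $\theta$ has axis-parallel sides then $q$ is $c_2$-adjacent but not $c_1$-adjacent to $p$, and if $\theta$ has slanted sides then $q$ is $c_1$-adjacent to $p$. (iii) For every vertex $p$ of a $135^\circ$ interior angle $\theta$ of $S$, $X$ is $135^\circ$-thick at $p$: there are $b,b'\in X$ in the interior of $\theta$ with $b$ $c_2$-adjacent but not $c_1$-adjacent to $p$, and $b'$ $c_1$-adjacent to $p$. Convexity: $hull(Y)$ is the convex hull of $Y$ in $\mathbb{R}^2$;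 when it is a polygonal disk, its vertices are the endpoints of its edges. A digital disk $X$ is (digitally) convex if it has a bounding curve $S$ such that the endpoints of the maximal line segments of $S$ are the vertices of $hull(X)\subset\mathbb{R}^2$. *)

(* Defs.v *)
From HB Require Import structures.
From mathcomp Require Import all_boot all_order all_algebra.
From mathcomp Require Import all_classical all_reals all_analysis.

Set Implicit Arguments.
Unset Strict Implicit.
Unset Printing Implicit Defensive.

Import Order.TTheory GRing.Theory Num.Theory.
Import numFieldNormedType.Exports.

Local Open Scope classical_set_scope.
Local Open Scope ring_scope.

Definition pt : Type := (int * int)%type.

Definition c2 : rel pt := fun x y =>
  [&& x != y, `|x.1 - y.1| <= 1 & `|x.2 - y.2| <= 1].

Definition c1 : rel pt := fun x y =>
  c2 x y && ((x.1 != y.1) (+) (x.2 != y.2)).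

Definition kpath (K : rel pt) (Y : set pt) (k : nat) (s : nat -> pt) : Prop :=
  (forall i, (i <= k)%N -> Y (s i)) /\
  (forall i, (i < k)%N -> s i = s i.+1 \/ K (s i) (s i.+1)).

Definition joined (K : rel pt) (Y : set pt) (k : nat) (x y : pt) : Prop :=
  exists s, [/\ kpath K Y k s, s 0%N = x & s k = y].

Definition kconnected (K : rel pt) (Y : set pt) : Prop :=
  forall x y, Y x -> Y y -> exists k, joined K Y k x y.

Definition is_component (K : rel pt) (Y C : set pt) : Prop :=
  exists2 x, Y x & C = [set y | exists k, joined K Y k x y].

Definition is_dist (K : rel pt) (Y : set pt) (x y : pt) (d : nat) : Prop :=
  joined K Y d x y /\ forall k, joined K Y k x y -> (d <= k)%N.

(* Self-maps of [X] are represented by total maps; only values on [X] matter. *)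
Definition continuous_self (K : rel pt) (X : set pt) (f : pt -> pt) : Prop :=
  (forall x, X x -> X (f x)) /\
  (forall x y, X x -> X y -> K x y -> f x = f y \/ K (f x) (f y)).

Definition freezing_set (K : rel pt) (X A : set pt) : Prop :=
  A `<=` X /\
  forall f, continuous_self K X f -> (forall a, A a -> f a = a) ->
    forall x, X x -> f x = x.

(* Cold sets are only defined for connected [(X, K)]. *)
Definition cold_set (K : rel pt) (X A : set pt) : Prop :=
  [/\ kconnected K X, A `<=` X &
  forall f, continuous_self K X f -> (forall a, A a -> f a = a) ->
    forall x, X x -> exists2 d, is_dist K X x (f x) d & (d <= 1)%N].

Definition closed_curve (s : nat -> pt) (m : nat) : Prop :=
  [/\ kpath c2 setT m s, s 0%N = s m &
      forall i j, (i < j <= m)%N -> (j - i < m)%N -> s i <> s j].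

Definition curve_pts (s : nat -> pt) (m : nat) : set pt :=
  s @` [set i | (i <= m)%N].

(* For a separating curve there is exactly one finite component. *)
Definition Int (S : set pt) : set pt :=
  \bigcup_(C in [set C | is_component c1 (~` S) C /\ finite_set C]) C.

Definition separating (S : set pt) : Prop :=
  exists I E : set pt,
    [/\ finite_set I, infinite_set E
      & forall C, is_component c1 (~` S) C <-> C = I \/ C = E].

Definition bounding_curve (X : set pt) (s : nat -> pt) (m : nat) : Prop :=
  let S := curve_pts s m in
  [/\ closed_curve s m, separating S & X = S `|` Int S].

Definition digital_disk (X : set pt) : Prop :=
  exists s m, bounding_curve X s m.

Definition collinear (L : set pt) : Prop :=
  exists a b c : int, (a, b) != (0, 0) /\
    forall x, L x -> a * x.1 + b * x.2 = c.

Definition digital_segment (L : set pt) : Prop :=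
  [/\ kconnected c1 L \/ kconnected c2 L, collinear L
    & exists x y, [/\ L x, L y & x <> y]].

(* Cyclic indexing of a closed curve, so that arcs may run through [s 0]. *)
Definition cyc (s : nat -> pt) (m i : nat) : pt := s (i %% m)%N.

Definition arc (s : nat -> pt) (m i k : nat) : set pt :=
  cyc s m @` [set j | (i <= j <= i + k)%N].

(* A segment of the curve consists of consecutive points of the curve. Points
   that are aligned in the plane without being consecutive do not count: next
   to a right angle with axis-parallel sides, the two neighbors of the vertex
   are diagonal neighbors of each other. *)
Definition edge (s : nat -> pt) (m i k : nat) : Prop :=
  digital_segment (arc s m i k) /\
  forall i' k', digital_segment (arc s m i' k') ->
    arc s m i k `<=` arc s m i' k' -> arc s m i' k' = arc s m i k.

Definition edge_endpoint (s : nat -> pt) (m : nat) (p : pt) : Prop :=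
  exists i k, edge s m i k /\ (p = cyc s m i \/ p = cyc s m (i + k)).

Definition dot (u v : pt) : int := u.1 * v.1 + u.2 * v.2.

Definition slanted (u : pt) : bool := (u.1 != 0) && (u.2 != 0).

(* The edges [arc s m i k] and [arc s m (i + k) l] meet exactly at the vertex
   [p]; [u] and [v] are the unit lattice steps from [p] along these edges. *)
Definition vertex_angle (s : nat -> pt) (m : nat) (p u v : pt) : Prop :=
  exists i k l,
    [/\ edge s m i k, edge s m (i + k) l,
        arc s m i k `&` arc s m (i + k) l = [set p],
        u = cyc s m (i + k).-1 - p & v = cyc s m (i + k).+1 - p].

(* cos 90 = 0. *)
Definition angle90 (u v : pt) : bool := dot u v == 0.

(* cos 135 = - sqrt 2 / 2. *)
Definition angle135 (u v : pt) : bool :=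
  (dot u v < 0) && (2 * dot u v ^+ 2 == dot u u * dot v v).

Section RealPlane.
Variable R : realType.

Definition emb (p : pt) : R^o * R^o := (p.1%:~R, p.2%:~R).

Definition hull (X : set pt) : set (R^o * R^o) :=
  smallest (@convex_set R (R^o * R^o)%type) (emb @` X).

Definition frontier (H : set (R^o * R^o)) : set (R^o * R^o) :=
  closure H `\` interior H.

Definition segment (a b : R^o * R^o) : set (R^o * R^o) :=
  [set (1 - t) *: a + t *: b | t in [set t : R | 0 <= t <= 1]].

Definition polygon_edge (H : set (R^o * R^o)) (a b : R^o * R^o) : Prop :=
  [/\ a <> b, segment a b `<=` frontier H &
    forall a' b', segment a' b' `<=` frontier H ->
      segment a b `<=` segment a' b' -> segment a' b' = segment a b].

Definition polygon_vertex (H : set (R^o * R^o)) (z : R^o * R^o) : Prop :=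
  exists a b, polygon_edge H a b /\ (z = a \/ z = b).

Definition convex_disk (X : set pt) : Prop :=
  exists s m, bounding_curve X s m /\
    forall z, polygon_vertex (hull X) z <->
      exists2 p, edge_endpoint s m p & z = emb p.

Definition trace (s : nat -> pt) (m : nat) : set (R^o * R^o) :=
  \bigcup_(i in [set i | (i < m)%N]) segment (emb (s i)) (emb (s i.+1)).

(* The region of the plane, cut along the closed polygon through the points of
   the curve, in which [Int] of the curve lies. *)
Definition inner_region (s : nat -> pt) (m : nat) : set (R^o * R^o) :=
  [set z | exists2 q, Int (curve_pts s m) q &
           connected_component (~` trace s m) z (emb q)].

(* From the point [p] of the curve, the direction [w] leads to the side on
   which [Int] lies. *)
Definition points_inside (s : nat -> pt) (m : nat) (p w : pt) : Prop :=
  \forall e \near (0 : R)^'+, inner_region s m (emb p + e *: emb w).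

(* Open convex sector with apex [p] and sides in directions [u] and [v]. *)
Definition in_sector (p u v q : pt) : Prop :=
  exists a b : R,
    [/\ 0 < a, 0 < b & emb q = emb p + (a *: emb u + b *: emb v)].

(* The convex sector between [u] and [v] (containing the direction [u + v]),
   rather than its complement, is the interior angle at [p]. *)
Definition interior_angle (s : nat -> pt) (m : nat) (p u v : pt) : Prop :=
  vertex_angle s m p u v /\ points_inside s m p (u + v).

Definition slant_thick (X : set pt) (s : nat -> pt) (m : nat) : Prop :=
  forall i k j, edge s m i k -> (i < j < i + k)%N ->
    let p := cyc s m j in
    let d := cyc s m j.+1 - p in
    slanted d ->
    exists c, [/\ X c, c2 c p && ~~ c1 c p, dot (c - p) d = 0
                & points_inside s m p (c - p)].

Definition thick90 (s : nat -> pt) (m : nat) : Prop :=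
  forall p u v, interior_angle s m p u v -> angle90 u v ->
    exists q, [/\ Int (curve_pts s m) q, in_sector p u v q
                & if slanted u then c1 q p else c2 q p && ~~ c1 q p].

Definition thick135 (X : set pt) (s : nat -> pt) (m : nat) : Prop :=
  forall p u v, interior_angle s m p u v -> angle135 u v ->
    exists b b', [/\ X b, X b', in_sector p u v b, in_sector p u v b'
                   & [/\ c2 b p, ~~ c1 b p & c1 b' p]].

Definition thick (X : set pt) : Prop :=
  exists s m, [/\ bounding_curve X s m, slant_thick X s m, thick90 s m
                & thick135 X s m].

End RealPlane.

(* Main.v *)
Require Import Defs.
From mathcomp Require Import all_boot all_order all_algebra.
From mathcomp Require Import all_classical all_reals all_analysis.
From mathcomp Require Import zify.

(* Cold implies freezing: let [f] fix the cold set [A] and move a point, hence by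
   distance one. For suitable signs the displacement [(u, v)] then satisfies
   [e1 * u + e2 * v = 1] somewhere, and the set of such points is closed under
   moving against [(e1, 0)] and [(0, e2)]; so it contains a corner [p], from
   which neither move is possible in [X]. If the neighbors of [p] have a common
   neighbor in [X] other than [p], the map moving only [p] there contradicts
   coldness. Otherwise [p] has two neighbors [y = f p] and [y'], and [f y' = p]
   is forced, so that [f \o f] moves [y'] to [y], by distance two.

   Freezing implies cold as soon as [X] is c1-connected. At a diagonal step of
   the bounding curve one of the two other corners of the unit square is in [X]:
   the parity of the number of crossings of the curve with a ray is 0 on the
   infinite component, and differs between these two corners if both are off
   the curve. *)

Local Open Scope classical_set_scope.
Section DigitalPlane.
Set Implicit Arguments.
Unset Strict Implicit.
Import Order.TTheory GRing.Theory Num.Theory.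
Local Open Scope ring_scope.

(** * Adjacency as l1-distance one, and reachability along c1-paths *)

Lemma c1E (x y : pt) : c1 x y = (`|x.1 - y.1| + `|x.2 - y.2| == 1).
Proof.
case: x y => [x1 x2] [y1 y2]; rewrite /c1 /c2 -pair_eqE /=; lia.
Qed.

Definition reach (Y : set pt) (x y : pt) : Prop := exists k, joined c1 Y k x y.

Lemma reach_refl (Y : set pt) (x : pt) : Y x -> reach Y x x.
Proof. by move=> Yx; exists 0%N, (fun=> x); split => //; split. Qed.

Lemma reach_step (Y : set pt) (x y z : pt) :
  reach Y x y -> Y z -> c1 y z -> reach Y x z.
Proof.
move=> [k [s [[Ys ss] s0 sk]]] Yz yz.
exists k.+1, (fun i => if (i <= k)%N then s i else z); split => //; last first.
  by rewrite ltnn.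
split=> i; first by case: ifP => // + _; exact: Ys.
rewrite ltnS => ik; rewrite ik; case: ltnP => [ik'|ki]; first exact: ss.
have -> : i = k by lia.
by right; rewrite sk.
Qed.

Lemma reach_ind (Y : set pt) (P : pt -> Prop) (x : pt) :
  P x -> (forall y z, Y y -> Y z -> P y -> c1 y z -> P z) ->
  forall y, reach Y x y -> P y.
Proof.
move=> Px PS y [k [s [[Ys ss] s0 <-]]].
suff : forall i, (i <= k)%N -> P (s i) by apply.
elim=> [|i IH] ik; first by rewrite s0.
have Pi : P (s i) by apply: IH; lia.
case: (ss i ik) => [<- //|]; apply: PS Pi; apply: Ys => //; lia.
Qed.

Lemma reach_trans (Y : set pt) (y x z : pt) :
  reach Y x y -> reach Y y z -> reach Y x z.
Proof.
move=> xy; apply: (reach_ind (P := reach Y x)) => // u v _ Yv xu uv.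
exact: reach_step uv.
Qed.

Lemma c1_sym (x y : pt) : c1 x y -> c1 y x.
Proof. by rewrite !c1E; lia. Qed.

Lemma reach_mem (Y : set pt) (x y : pt) : reach Y x y -> Y x /\ Y y.
Proof.
move=> [k [s [[Ys _] <- <-]]]; split; exact: Ys.
Qed.

Lemma reach_sym (Y : set pt) (x y : pt) : reach Y x y -> reach Y y x.
Proof.
move=> xy; have [Yx _] := reach_mem xy.
move: y xy; apply: reach_ind; first exact: reach_refl.
move=> u v Yu Yv ux /c1_sym vu.
apply: reach_trans ux; apply: reach_step vu => //; exact: reach_refl.
Qed.

Lemma finite_bound (X : set pt) : finite_set X ->
  exists B : int, forall x, X x -> `|x.1| + `|x.2| <= B.
Proof.
case/finite_seqP => r ->; elim: r => [|y r [B IH]]; first by exists 0.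
exists (`|B| + (`|y.1| + `|y.2|)) => x /=; rewrite in_cons => /orP[/eqP ->|xr].
  by lia.
by have := IH x xr; lia.
Qed.

(** Equality or adjacency as one linear inequality in the plane, so that [lia] can replace path
    distances in [X]. *)
Definition c1_le1 (x y : pt) := `|x.1 - y.1| + `|x.2 - y.2| <= 1.

Lemma c1_le1P (x y : pt) : c1_le1 x y <-> x = y \/ c1 x y.
Proof.
rewrite /c1_le1 c1E; split; case: x y => [x1 x2] [y1 y2] /=.
  have [E|] := eqVneq (x1, x2) (y1, y2); first by left.
  by rewrite -pair_eqE /= => *; right; lia.
by case=> [[-> ->]|]; lia.
Qed.

(** * From cold to freezing: corners and the descent to them *)

Section Cold.
Variables X A : set pt.
Hypothesis coldA : cold_set c1 X A.

Lemma cold_near (f : pt -> pt) : continuous_self c1 X f ->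
  (forall a, A a -> f a = a) -> forall x, X x -> c1_le1 x (f x).
Proof.
case: coldA => _ _ H cf fA x Xx; apply/c1_le1P.
have [[|[|d]] // [[s [[_ ss] <- <-]] _] _] := H f cf fA x Xx; first by left.
exact: ss.
Qed.

(** The map that moves only [p], to [z], is continuous by the hypothesis on neighbors and fixes [A],
    so coldness bounds how far [p] moves. *)
Lemma cold_moved (p z : pt) : X p -> X z -> ~ A p ->
  (forall y, X y -> c1 p y -> c1 z y) -> c1_le1 p z.
Proof.
move=> Xp Xz Ap nb.
pose g x := if x == p then z else x.
have -> : z = g p by rewrite /g eqxx.
apply: cold_near => //; rewrite /g.
- split=> [x Xx|x y Xx Xy xy]; first by case: ifP.
  case: eqVneq => [xp|_]; case: eqVneq => [yp|_]; [by left| | |by right].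
  + by right; apply: nb => //; rewrite -xp.
  + by right; apply/c1_sym/nb => //; rewrite -yp; exact: c1_sym.
- by move=> a Aa; case: eqVneq => // ap; case: Ap; rewrite -ap.
Qed.

Lemma continuous_self_comp (f : pt -> pt) : continuous_self c1 X f ->
  continuous_self c1 X (f \o f).
Proof.
move=> [fX fc]; split=> [x Xx|x y Xx Xy xy] /=; first exact/fX/fX.
have [->|fxy] := fc x y Xx Xy xy; first by left.
by apply: fc => //; exact: fX.
Qed.

Hypothesis largeX : forall p y, exists r, [/\ X r, r <> p & r <> y].

Lemma cold_corner (f : pt -> pt) (p y : pt) (e1 e2 : int) :
  continuous_self c1 X f -> (forall a, A a -> f a = a) -> X p ->
  `|e1| = 1 -> `|e2| = 1 -> (y = (p.1 + e1, p.2) \/ y = (p.1, p.2 + e2)) ->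
  f p = y -> ~ X (p.1 - e1, p.2) -> ~ X (p.1, p.2 - e2) -> False.
Proof.
move=> cf fA Xp e1P e2P yP fp nL nD.
have Xy : X y by rewrite -fp; apply: cf.1.
have nAp : ~ A p.
  move=> /fA; rewrite fp => yp; case: yP; rewrite yp; case: (p) => p1 p2 [] /=; lia.
(* [y'] is the other possible neighbor, [z] the fourth corner of the square *)
pose y' : pt := (p.1 + (p.1 + e1 - y.1), p.2 + (p.2 + e2 - y.2)).
pose z : pt := (p.1 + e1, p.2 + e2).
have nbp u : X u -> c1 p u -> u = y \/ u = y'.
  move=> Xu; have [uL|/eqP uL] := pselect (u = (p.1 - e1, p.2)).
    by case: nL; rewrite -uL.
  have [uD|/eqP uD] := pselect (u = (p.1, p.2 - e2)).
    by case: nD; rewrite -uD.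
  rewrite c1E => pu.
  suff : (u == y) || (u == y') by case/orP => /eqP; [left|right].
  move: uL uD pu; rewrite /y'; case: (u) (p) yP => [u1 u2] [p1 p2] [] -> /=;
  rewrite -!pair_eqE /=; lia.
(* If [y'] is missing, [y] is the only neighbor of [p]. Connectedness and a third point give [y]
   another neighbor [q], and [p] can be moved to [q], at distance two. *)
have [Xy'|nXy'] := pselect (X y'); last first.
  have {}nbp u : X u -> c1 p u -> u = y.
    by move=> Xu /(nbp u Xu)[] // E; case: nXy'; rewrite -E.
  have [q Xq [yq qp]] : exists2 q, X q & c1 y q /\ q <> p.
    apply: contrapT => nq.
    have [r [Xr rp ry]] := largeX p y.
    have [conX _ _] := coldA.
    suff : r = p \/ r = y by case.
    apply: (reach_ind (Y := X) (P := fun r => r = p \/ r = y)) (conX p r Xp Xr).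
      by left.
    move=> u v Xu Xv [] -> uv; first by right; exact: nbp.
    by left; apply: contrapT => vp; apply: nq; exists v.
  have nq : ~ c1_le1 p q.
    move: qp yq; rewrite c1E /c1_le1; case: (q) (p) yP => [q1 q2] [p1 p2] yP /eqP.
    rewrite -pair_eqE /=; case: yP => -> /=; lia.
  by apply: nq; apply: cold_moved => // u Xu /(nbp u Xu) ->; exact: c1_sym.
(* The corner [z] is adjacent to both [y] and [y'], so [p] could be moved to [z], again at distance
   two. *)
have [Xz|nXz] := pselect (X z).
  have : c1_le1 p z.
    apply: cold_moved => // u Xu /(nbp u Xu) uP.
    rewrite c1E; move: uP; rewrite /y' /z.
    case: (p) yP => p1 p2 [] -> /= [] -> /=; lia.
  rewrite /c1_le1 /z /=; lia.
(* Only [p] and [z] are within distance one of both [y'] and [f p = y], and [z] is off [X]. *)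
have fy' : f y' = p.
  have : f p = f y' \/ c1 (f p) (f y').
    apply: cf.2 => //; rewrite c1E /y'; case: (p) yP => p1 p2 [] -> /=; lia.
  rewrite fp -c1_le1P => yfy'.
  have y'fy' := cold_near cf fA Xy'.
  have /eqP fz : f y' <> z by move=> E; apply: nXz; rewrite -E; apply: cf.1.
  apply/eqP; move: yfy' y'fy' fz; rewrite /c1_le1.
  case: (f y') => q1 q2; rewrite /z /y'; case: (p) yP => p1 p2 [] -> /=.
    rewrite -!pair_eqE /=; lia.
  rewrite -!pair_eqE /=; lia.
have := cold_near (continuous_self_comp cf) _ Xy'.
rewrite /= fy' fp => H.
have : c1_le1 y' y by apply: H => a Aa /=; rewrite !fA.
rewrite /c1_le1 /y'; case: (p) yP => p1 p2 [] -> /=; lia.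
Qed.

Hypothesis finX : finite_set X.

Lemma cold_freezing : freezing_set c1 X A.
Proof.
have [_ AX _] := coldA; split => // f cf fA x Xx.
apply: contrapT => /eqP fx.
have [e1 [e2 [e1P e2P ex]]] : exists e1 e2 : int, [/\ `|e1| = 1, `|e2| = 1 &
    e1 * ((f x).1 - x.1) + e2 * ((f x).2 - x.2) = 1].
  have := cold_near cf fA Xx; move: fx; rewrite /c1_le1.
  move: (f x) => y; case: x y {Xx} => [x1 x2] [y1 y2]; rewrite -pair_eqE /= => ne nr.
  have /or4P : [|| y1 - x1 == 1, y1 - x1 == -1, y2 - x2 == 1 | y2 - x2 == -1].
    by lia.
  by case=> ?; [exists 1, 1|exists (-1), 1|exists 1, 1|exists 1, (-1)]; split; lia.
have [B BX] := finite_bound finX.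
have {}e1P : e1 = 1 \/ e1 = -1 by lia.
have {}e2P : e2 = 1 \/ e2 = -1 by lia.
(* Descent on [B + e1 * y.1 + e2 * y.2], which is nonnegative on [X] by the choice of [B]. *)
suff H (n : nat) y : X y -> e1 * ((f y).1 - y.1) + e2 * ((f y).2 - y.2) = 1 ->
    B + e1 * y.1 + e2 * y.2 < n%:Z -> False.
  apply: (H (absz (B + e1 * x.1 + e2 * x.2 + 1)) x) => //; lia.
elim: n y => [|n IH] y Xy ey yn.
  by have := BX y Xy; case: e1P => ?; case: e2P => ?; subst e1 e2; lia.
(* At [u] the signed displacement is at least 1 by continuity and at most 1 by coldness, so the
   descent continues from [u]. *)
have far u : X u -> c1 y u -> e1 * (y.1 - u.1) + e2 * (y.2 - u.2) = 1 -> False.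
  move=> Xu yu eu; have /c1_le1P fyu := cf.2 _ _ Xy Xu yu.
  have fu := cold_near cf fA Xu.
  apply: (IH u) => //; move: ey fyu fu eu yn; rewrite /c1_le1;
  by case: e1P => ?; case: e2P => ?; subst e1 e2; lia.
have fy := cold_near cf fA Xy.
apply: (@cold_corner f y (f y) e1 e2) => //.
- lia.
- lia.
- suff : (f y == (y.1 + e1, y.2)) || (f y == (y.1, y.2 + e2)).
    by case/orP => /eqP; [left|right].
  move: fy ey; rewrite /c1_le1; case: (f y) => q1 q2; rewrite -!pair_eqE /=.
  by case: e1P => ?; case: e2P => ?; subst e1 e2; lia.
- move=> Xu; apply: far Xu _ _ => /=; rewrite ?c1E /=;
  by case: e1P => ?; case: e2P => ?; subst e1 e2; lia.
- move=> Xu; apply: far Xu _ _ => /=; rewrite ?c1E /=;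
  by case: e1P => ?; case: e2P => ?; subst e1 e2; lia.
Qed.
End Cold.

(** * Parity of the crossings of a closed curve with a horizontal ray *)

(* The ray starts at [(a, b + 1/2)] and goes right: it avoids lattice points, and
   a step meets it in its midpoint. *)
Definition cross (a b : int) (x y : pt) : bool :=
  ((x.2 <= b) (+) (y.2 <= b)) && (2 * a < x.1 + y.1).

Definition parity (s : nat -> pt) (m : nat) (a b : int) : bool :=
  \big[addb/false]_(i < m) cross a b (s i) (s i.+1).

(** A step that meets only one of the two rays has its midpoint at abscissa [a + 1/2] or [a + 1]. *)
Lemma cross_square (a b : int) (x y : pt) :
  `|x.1 - y.1| <= 1 -> `|x.2 - y.2| <= 1 ->
  cross a b x y (+) cross (a + 1) b x y ->
  [/\ (x.1 \in [:: a; a + 1]) && (x.2 \in [:: b; b + 1]),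
      (y.1 \in [:: a; a + 1]) && (y.2 \in [:: b; b + 1]) & x.2 != y.2].
Proof.
rewrite /cross !inE; case: x y => [x1 x2] [y1 y2] /= d1 d2.
case: (lerP x2 b) => xb; case: (lerP y2 b) => yb //=.
  by case: (ltrP (2 * a)) => H; case: (ltrP (2 * (a + 1))) => H' //= _; split; lia.
by case: (ltrP (2 * a)) => H; case: (ltrP (2 * (a + 1))) => H' //= _; split; lia.
Qed.

Lemma addb_telescope (W : nat -> bool) (m : nat) :
  \big[addb/false]_(i < m) (W i (+) W i.+1) = W 0%N (+) W m.
Proof.
elim: m => [|m IH]; first by rewrite big_ord0 addbb.
by rewrite big_ord_recr /= IH addbA addbK.
Qed.

Section Disk.
Variables (s : nat -> pt) (m : nat) (I E : set pt).
Let S := curve_pts s m.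
Hypothesis curve_s : closed_curve s m.
Hypotheses (finI : finite_set I) (infE : infinite_set E).
Hypothesis compS : forall C, is_component c1 (~` S) C <-> C = I \/ C = E.
Let X := S `|` Int S.

Lemma curve_mem (i : nat) : (i <= m)%N -> S (s i).
Proof. by move=> im; exists i. Qed.

Lemma curve_step (i : nat) : (i < m)%N ->
  `|(s i).1 - (s i.+1).1| <= 1 /\ `|(s i).2 - (s i.+1).2| <= 1.
Proof.
case: curve_s => [[_ st] _ _] im; case: (st i im) => [->|].
  by rewrite !subrr.
by rewrite /c2 => /and3P[].
Qed.

(** The sums agree term by term: a step counted only once would have its lower end at [(a, b)] or
    [(a + 1, b)]. *)
Lemma parity_right (a b : int) : ~ S (a, b) -> ~ S (a + 1, b) ->
  parity s m a b = parity s m (a + 1) b.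
Proof.
move=> nS nS'; apply: eq_bigr => i _; have im := ltn_ord i.
have off j : (j <= m)%N -> (s j != (a, b)) && (s j != (a + 1, b)).
  by move=> jm; apply/andP; split; apply/eqP => e; [case: nS|case: nS'];
  rewrite -e; exact: curve_mem.
have := off i (ltnW im); have := off i.+1 im; have := curve_step im.
case: (s i) (s i.+1) => [x1 x2] [y1 y2]; rewrite /cross -!pair_eqE /=; lia.
Qed.

Lemma parity_up (a b : int) : ~ S (a, b + 1) ->
  parity s m a b = parity s m a (b + 1).
Proof.
(* A step meets exactly one of the two rays iff it enters or leaves the part of
   row [b + 1] to the right of [a]. *)
pose W i := ((s i).2 == b + 1) && (a < (s i).1) => nS.
suff : parity s m a b (+) parity s m a (b + 1) = false.
  by case: parity; case: parity.
have [_ s0m _] := curve_s.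
rewrite -big_split /=.
transitivity (W 0%N (+) W m); last by rewrite /W s0m addbb.
rewrite -addb_telescope; apply: eq_bigr => i _; have im := ltn_ord i.
have off j : (j <= m)%N -> s j != (a, b + 1).
  by move=> jm; apply/eqP => e; case: nS; rewrite -e; exact: curve_mem.
have := off i (ltnW im); have := off i.+1 im; have := curve_step im.
rewrite /W; case: (s i) (s i.+1) => [x1 x2] [y1 y2].
by rewrite /cross -!pair_eqE /=; lia.
Qed.

Lemma parity_reach (x y : pt) : reach (~` S) x y ->
  parity s m x.1 x.2 = parity s m y.1 y.2.
Proof.
move: y; apply: (reach_ind (P := fun y => _ = parity s m y.1 y.2)) => //.
move=> [y1 y2] [z1 z2] nSy nSz -> /=; rewrite c1E /= => yz.
have : [|| (y1 == z1) && (y2 == z2 + 1), (y1 == z1) && (z2 == y2 + 1),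
  (y2 == z2) && (y1 == z1 + 1) | (y2 == z2) && (z1 == y1 + 1)] by lia.
case/or4P => /andP[/eqP e /eqP e']; subst.
- exact/esym/parity_up.
- exact: parity_up.
- exact/esym/parity_right.
- exact: parity_right.
Qed.

Lemma finite_curve : finite_set S.
Proof.
apply: finite_image; apply: (@sub_finite_set _ _ `I_m.+1) (finite_II _).
by move=> i /=; rewrite ltnS.
Qed.

Lemma far_point : exists2 q, E q & parity s m q.1 q.2 = false.
Proof.
have [B SB] := finite_bound finite_curve.
have [_ s0m _] := curve_s.
have bnd i : (i <= m)%N -> `|(s i).1| + `|(s i).2| <= B.
  by move=> im; exact/SB/curve_mem.
have [q Eq qB] : exists2 q, E q & (B < `|q.1|) || (B < `|q.2|).
  apply: contrapT => nE; apply: infE.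
  pose K := absz (B + B + 1).
  apply: (@sub_finite_set _ _
    ((fun u : nat * nat => (u.1%:Z - B, u.2%:Z - B) : pt) @` (`I_K `*` `I_K))).
    move=> q Eq; have qB : ~~ ((B < `|q.1|) || (B < `|q.2|)).
      by apply/negP => qB; apply: nE; exists q.
    exists (absz (q.1 + B), absz (q.2 + B)); first by rewrite /K; split => /=; lia.
    apply/eqP; case: (q) qB => q1 q2; rewrite -pair_eqE /=; lia.
  by apply: finite_image; apply: finite_setX; exact: finite_II.
exists q => //; rewrite /parity.
(* To the left of the curve, the ray meets every step that changes sides of its line, and these
   changes telescope to zero on a closed curve. Otherwise the ray meets no step. *)
have [qL|qR] := boolP (q.1 < - B).
  transitivity (((s 0%N).2 <= q.2) (+) ((s m).2 <= q.2)); last first.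
    by rewrite s0m addbb.
  rewrite -(addb_telescope (fun i => (s i).2 <= q.2)).
  apply: eq_bigr => i _; have im := ltn_ord i.
  by rewrite /cross; have := bnd i (ltnW im); have := bnd i.+1 im; lia.
rewrite big1 // => i _; have im := ltn_ord i.
by rewrite /cross; have := bnd i (ltnW im); have := bnd i.+1 im; lia.
Qed.

(** * Inside and outside of the curve *)

Lemma component_reach (C : set pt) (x y : pt) :
  C = I \/ C = E -> C x -> reach (~` S) x y -> C y.
Proof.
move=> /compS[z _ ->]; exact: reach_trans.
Qed.

Lemma component_joined (C : set pt) (x y : pt) :
  C = I \/ C = E -> C x -> C y -> reach (~` S) x y.
Proof.
move=> /compS[z _ ->] zx zy; exact: reach_trans (reach_sym zx) zy.
Qed.

Lemma I_Int : I `<=` Int S.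
Proof.
by move=> x Ix; exists I => //; split => //; apply/compS; left.
Qed.

Lemma Int_I : Int S `<=` I.
Proof.
move=> x [C [/compS[->//|->]]] /infE [].
Qed.

(** The component of [q] cannot be [I], which lies in [X]. It is therefore [E], on which the parity
    is constant and vanishes at a far point. *)
Lemma outside_parity (q : pt) : ~ X q -> parity s m q.1 q.2 = false.
Proof.
move=> nXq; have nSq : ~ S q by move=> Sq; apply: nXq; left.
have : is_component c1 (~` S) [set y | reach (~` S) q y] by exists q.
have qq : reach (~` S) q q by exact: reach_refl.
move=> /compS[CI|CE].
  by case: nXq; right; apply: I_Int; rewrite -CI.
have [r Er rP] := far_point.
rewrite -rP; apply: parity_reach; apply: (@component_joined E) => //; first by right.
by rewrite -CE.
Qed.

Lemma I_off : I `<=` ~` S.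
Proof.
have /compS[z nSz ->] : I = I \/ I = E by left.
by move=> x zx; have [] : (~` S) z /\ (~` S) x by exact: reach_mem zx.
Qed.

(** A straight walk that never met the curve would stay in [I] forever, against finiteness. *)
Lemma walk (x d : pt) : I x -> `|d.1| + `|d.2| = 1 -> exists n : nat,
  S (x.1 + n%:Z * d.1, x.2 + n%:Z * d.2) /\
  forall j : nat, (j < n)%N -> I (x.1 + j%:Z * d.1, x.2 + j%:Z * d.2).
Proof.
move=> Ix d1; apply: contrapT => nS.
have II (n : nat) : forall j : nat, (j < n.+1)%N ->
    I (x.1 + j%:Z * d.1, x.2 + j%:Z * d.2).
  elim: n => [|n IH] j.
    by rewrite ltnS leqn0 => /eqP ->; rewrite !mul0r !addr0; case: (x) Ix.
  rewrite ltnS leq_eqVlt => /orP[/eqP ->|]; last exact: IH.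
  have In := IH n (ltnSn n).
  apply: (component_reach _ In); first by left.
  have nSn : ~ S (x.1 + n.+1%:Z * d.1, x.2 + n.+1%:Z * d.2).
    by move=> Sn; apply: nS; exists n.+1.
  apply: reach_step (reach_refl (I_off In)) nSn _.
  rewrite c1E /=; lia.
have [B IB] := finite_bound finI.
pose n := absz (`|B| + `|x.1| + `|x.2| + 1).
have := IB _ (II n n (ltnSn n)); have : n%:Z = `|B| + `|x.1| + `|x.2| + 1.
  by rewrite /n; lia.
have : [|| (d.1 == 0) && (d.2 == 1), (d.1 == 0) && (d.2 == -1),
  (d.2 == 0) && (d.1 == 1) | (d.2 == 0) && (d.1 == -1)] by lia.
by case/or4P => /andP[/eqP -> /eqP ->] /=; lia.
Qed.

(** Walks to the right, to the left and upwards from a point of [I] end at distinct points of [S],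
    since each has positive length. *)
Lemma three_curve_points : exists u v w,
  [/\ S u, S v, S w & [/\ u <> v, v <> w & u <> w]].
Proof.
have /compS[x nSx IE] : I = I \/ I = E by left.
have Ix : I x by rewrite IE; exact: reach_refl.
have [|n [Sn _]] := @walk x (1, 0) Ix; first by [].
have [|n' [Sn' _]] := @walk x (-1, 0) Ix; first by [].
have [|n'' [Sn'' _]] := @walk x (0, 1) Ix; first by [].
do 3 eexists; split; [exact: Sn|exact: Sn'|exact: Sn''|].
have pos (k : nat) d : S (x.1 + k%:Z * d.1, x.2 + k%:Z * d.2) -> k != 0%N.
  by apply: contraPneq => ->; rewrite !mul0r !addr0; case: (x) nSx.
have := pos _ _ Sn; have := pos _ _ Sn'; have := pos _ _ Sn''.
by move=> ? ? ?; split => -[] /=; lia.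
Qed.

(** * Diagonal steps of the curve and c1-connectedness of the disk *)

Lemma curve_size : (2 < m)%N.
Proof.
have [_ s0m _] := curve_s.
rewrite ltnNge; apply/negP => m2.
have S01 u : S u -> u = s 0%N \/ u = s 1%N.
  move=> [[|[|[|i]]] /= im <-]; [by left|by right|left|lia].
  by rewrite s0m; congr s; lia.
have [u [v [w [/S01 Su /S01 Sv /S01 Sw [uv vw uw]]]]] := three_curve_points.
by case: Su => ?; case: Sv => ?; case: Sw => ?; congruence.
Qed.

(** Injectivity up to closure excludes a repeated step; a reversed one could only occur for [m = 2],
    where the curve runs back along its first step. *)
Lemma curve_step_inj (i j : nat) : (i < m)%N -> (j < m)%N ->
  s i = s j /\ s i.+1 = s j.+1 \/ s i = s j.+1 /\ s i.+1 = s j -> i = j.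
Proof.
have m3 := curve_size; have [_ s0m inj] := curve_s.
wlog ij : i j / (i <= j)%N.
  move=> H im jm; have [ij|ji] := leqP i j; first exact: H.
  move=> e; apply/esym/H => //; first exact: ltnW.
  by case: e => -[-> ->]; [left|right].
move=> im jm; have [//|ne] := eqVneq i j.
case=> -[e e']; first by case: (@inj i j) => //; lia.
have [i0|i0] := eqVneq i 0%N; last by case: (@inj i j.+1) => //; lia.
have [ji|ji] := eqVneq j 1%N; last by case: (@inj i.+1 j) => //; lia.
by case: (@inj i j.+1) => //; lia.
Qed.

Lemma diagonal_corner (i : nat) : (i < m)%N ->
  (s i).1 != (s i.+1).1 -> (s i).2 != (s i.+1).2 ->
  X ((s i).1, (s i.+1).2) \/ X ((s i.+1).1, (s i).2).
Proof.
move=> im d1 d2; have [c c'] := curve_step im.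
apply: contrapT => /not_orP[nX1 nX2].
set q := (_, _) in nX1; set q' := (_, _) in nX2.
have nS1 : ~ S q by move=> ?; apply: nX1; left.
have nS2 : ~ S q' by move=> ?; apply: nX2; left.
(* [(a, b)] is the lower left corner of the unit square spanned by the step. *)
pose a := Num.min (s i).1 (s i.+1).1; pose b := Num.min (s i).2 (s i.+1).2.
have aP : (s i).1 = a /\ (s i.+1).1 = a + 1 \/ (s i.+1).1 = a /\ (s i).1 = a + 1.
  by rewrite /a; lia.
have bP : (s i).2 = b /\ (s i.+1).2 = b + 1 \/ (s i.+1).2 = b /\ (s i).2 = b + 1.
  by rewrite /b; lia.
(* A corner off [X] in the upper row passes its parity down to row [b] by [parity_up]. *)
have col (u : pt) : ~ X u -> u.2 = b \/ u.2 = b + 1 -> parity s m u.1 b = false.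
  move=> nXu [ub|ub]; first by rewrite -ub outside_parity.
  rewrite parity_up -ub ?outside_parity //.
  by move=> Su; apply: nXu; left; case: (u) Su.
have [p0 p1] : parity s m a b = false /\ parity s m (a + 1) b = false.
  have := col _ nX1; have := col _ nX2; rewrite /q /q' /= => H1 H2.
  have {}H1 := H1 ltac:(rewrite /b; lia). have {}H2 := H2 ltac:(rewrite /b; lia).
  by case: aP => -[e e']; move: H1 H2; rewrite e e'.
have : parity s m a b (+) parity s m (a + 1) b = true; last by rewrite p0 p1.
(* The diagonal step crosses at abscissa [a + 1/2], so it meets the first ray only. Any other step
   that distinguishes the rays would have its ends among the corners of the square on the curve, and
   so coincide with this step up to direction. *)
rewrite -big_split /= (bigD1 (Ordinal im)) //= big1 ?addbF.
  by rewrite /cross /a /b; lia.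
move=> j ji; have jm := ltn_ord j; apply/negbTE/negP => cj.
have [s1 s2] := curve_step jm.
have [/andP[j1 j2] /andP[j1' j2'] j22] := cross_square s1 s2 cj.
have diag k : (k <= m)%N -> (s k).1 \in [:: a; a + 1] ->
    (s k).2 \in [:: b; b + 1] -> s k = s i \/ s k = s i.+1.
  move=> km k1 k2.
  have {}k1 : (s k).1 = (s i).1 \/ (s k).1 = (s i.+1).1.
    by move: k1; rewrite !inE => /orP[] /eqP ->; case: aP => -[-> ->]; auto.
  have {}k2 : (s k).2 = (s i).2 \/ (s k).2 = (s i.+1).2.
    by move: k2; rewrite !inE => /orP[] /eqP ->; case: bP => -[-> ->]; auto.
  have eq_pt (u v : pt) : u.1 = v.1 -> u.2 = v.2 -> u = v.
    by case: u v => ? ? [? ?] /= -> ->.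
  have Sk := curve_mem km; case: k1 k2 => k1 [] k2.
  - by left; exact: eq_pt.
  - by case: nS1; rewrite -(eq_pt (s k) q).
  - by case: nS2; rewrite -(eq_pt (s k) q').
  - by right; exact: eq_pt.
have {}j1 := diag j (ltnW jm) j1 j2; have {}j1' := diag j.+1 jm j1' j2'.
have ij : i = j.
  apply: (curve_step_inj im jm).
  case: j1 j1' j22 => -> [] ->; rewrite ?eqxx //; by [left|right].
by move: ji; rewrite -val_eqE /= -ij eqxx.
Qed.

Lemma reach_curve_step (i : nat) : (i < m)%N -> reach X (s i) (s i.+1).
Proof.
move=> im; have [c c'] := curve_step im.
have Xi : X (s i) by left; exact/curve_mem/ltnW.
have Xi1 : X (s i.+1) by left; exact: curve_mem.
have Ri := reach_refl Xi.
have [e1|e1] := eqVneq (s i).1 (s i.+1).1.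
  have [e2|e2] := eqVneq (s i).2 (s i.+1).2.
    rewrite (_ : s i.+1 = s i) //; move: e1 e2.
    by case: (s i) (s i.+1) => ? ? [? ?] /= -> ->.
  by apply: reach_step Ri Xi1 _; rewrite c1E; lia.
have [e2|e2] := eqVneq (s i).2 (s i.+1).2.
  by apply: reach_step Ri Xi1 _; rewrite c1E; lia.
by case: (diagonal_corner im e1 e2) => Xc;
  (apply: (reach_step (reach_step Ri Xc _) Xi1); rewrite c1E /=; lia).
Qed.

(** The curve is c1-connected within [X] step by step, and an interior point walks horizontally
    through [I] until it meets the curve. *)
Lemma disk_connected : kconnected c1 X.
Proof.
have RS i : (i <= m)%N -> reach X (s 0%N) (s i).
  elim: i => [|i IH] im; first by apply: reach_refl; left; exact: curve_mem.
  exact: reach_trans (IH (ltnW im)) (reach_curve_step im).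
suff R x : X x -> reach X (s 0%N) x.
  by move=> x y Xx Xy; apply: reach_trans (reach_sym (R x Xx)) (R y Xy).
case=> [[i im <-]|/Int_I Ix]; first exact: RS.
have [|n [[i im si] In]] := @walk x (1, 0) Ix; first by [].
have Xn : X (x.1 + n%:Z * 1, x.2 + n%:Z * 0) by left; exists i.
apply: (reach_trans (RS i im)); rewrite si; apply: reach_sym.
have Xj (j : nat) : (j <= n)%N -> X (x.1 + j%:Z * 1, x.2 + j%:Z * 0).
  by rewrite leq_eqVlt => /orP[/eqP ->//|/In ?]; right; exact: I_Int.
have : forall j : nat, (j <= n)%N -> reach X x (x.1 + j%:Z * 1, x.2 + j%:Z * 0).
  elim=> [|j IH] jn.
    rewrite mul0r mulr0 !addr0; case: (x) (I_Int Ix) => ? ? Xx.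
    by apply: reach_refl; right.
  by apply: reach_step (IH (ltnW jn)) (Xj _ jn) _; rewrite c1E /=; lia.
by apply.
Qed.

Lemma finite_disk : finite_set X.
Proof.
rewrite finite_setU; split; first exact: finite_curve.
exact: sub_finite_set Int_I finI.
Qed.

Lemma disk_large (p y : pt) : exists r, [/\ X r, r <> p & r <> y].
Proof.
have [u [v [w [Su Sv Sw [uv vw uw]]]]] := three_curve_points.
have [up|up] := pselect (u = p \/ u = y); last first.
  by exists u; split; [left|move=> ?; apply: up; left|move=> ?; apply: up; right].
have [vp|vp] := pselect (v = p \/ v = y); last first.
  by exists v; split; [left|move=> ?; apply: vp; left|move=> ?; apply: vp; right].
exists w; split; first by left.
  by move=> ?; case: up vp => ? [] ?; congruence.
by move=> ?; case: up vp => ? [] ?; congruence.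
Qed.
End Disk.

(** * From freezing to cold, and the equivalence for disks *)

Lemma freezing_cold (X A : set pt) :
  kconnected c1 X -> freezing_set c1 X A -> cold_set c1 X A.
Proof.
move=> cX [AX fr]; split => // f cf fA x Xx; exists 0%N => //.
rewrite fr //; split => //.
by exists (fun=> x); split => //; split.
Qed.
End DigitalPlane.

Theorem theorem6p3 (R : realType) (X : set pt) (hX : digital_disk X)
    (hthick : thick R X) (hconvex : convex_disk R X)
    (A : set pt) (hA : A `<=` X) :
  cold_set c1 X A <-> freezing_set c1 X A.
Proof.
have [s [m [cs [I [E [fI iE comp]]] ->]]] := hX.
split; last by apply: freezing_cold; exact: disk_connected cs fI iE comp.
move=> cold; apply: (cold_freezing cold); last exact: finite_disk fI iE comp.
by move=> p y; exact: disk_large fI comp p y.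
Qed.
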